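(* Let $(X,\kappa_1)$ and $(Y,\kappa_2)$ be isomorphic digital images, let $i \geq 3$, and let $f_1,\ldots,f_i : X \to X$ be continuous maps. Then there exist continuous maps $g_1,\ldots,g_i : Y \to Y$ such that $\#C(f_1,\ldots,f_i) = \#C(g_1,\ldots,g_i)$.
   Context: A digital image is a pair $(X,\kappa)$ with $X$ a finite subset of $\mathbb{Z}^n$ for some $n\in\mathbb{N}$ and $\kappa$ a symmetric, antireflexive (irreflexive) relation on $X$, called the adjacency. A subset of $X$ is $\kappa$-connected if it is not a union of two disjoint non-empty sets $A,B$ such that no point of $A$ is $\kappa$-adjacent to a point of $B$. A function $f:(X,\kappa_1)\to(Y,\kappa_2)$ is (digitally) continuous if it maps every $\kappa_1$-connected subset of $X$ to a $\kappa_2$-connected subset of $Y$; equivalently, whenever $x,y\in X$ are $\kappa_1$-adjacent, $f(x)$ and $f(y)$ are equal or $\kappa_2$-adjacent. An isomorphism of digital images is a continuous bijection whose inverse is continuous. The coincidence point set of maps $f_1,\ldots,f_i$ with common domain $X$ and common codomain is $C(f_1,\ldots,f_i)=\{x\in X : f_1(x)=\cdots=f_i(x)\}$. $\#A$ denotes the cardinality of $A$. *)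

(* Defs.v *)
From mathcomp Require Import all_boot all_order all_algebra finmap.

Set Implicit Arguments.
Unset Strict Implicit.
Unset Printing Implicit Defensive.

(* A digital image in Z^n, with Z^n rendered as 'rV[int]_n.  The adjacency is a
   relation on the finite type of points of the subset, not on all of Z^n. *)
Record digital_image (n : nat) := DigitalImage {
  points : {fset 'rV[int]_n};
  adj : rel points;
  adj_sym : symmetric adj;
  adj_irr : irreflexive adj
}.

(* The finite type of points of X; X itself coerces to it. *)
Definition carrier (n : nat) (X : digital_image n) : finType := points X.
Coercion carrier : digital_image >-> finType.

(* The empty set is connected under this definition. *)
Definition connected (n : nat) (X : digital_image n) (S : {set X}) : Prop :=
  ~ exists A B : {set X},
      [/\ S = A :|: B, [disjoint A & B], A != set0, B != set0 &
          forall a b : X, a \in A -> b \in B -> ~~ adj a b].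

Definition continuous (m n : nat) (X : digital_image m) (Y : digital_image n)
    (f : X -> Y) : Prop :=
  forall S : {set X}, connected S -> connected (f @: S).

Definition isomorphic (m n : nat) (X : digital_image m) (Y : digital_image n) :
    Prop :=
  exists (h : X -> Y) (k : Y -> X),
    [/\ cancel h k, cancel k h, continuous h & continuous k].

Definition coincidence (I S T : finType) (f : I -> S -> T) : {set S} :=
  [set x | [forall j, forall k, f j x == f k x]].

(* Main.v *)
Require Import Defs.
From mathcomp Require Import all_boot all_order all_algebra finmap.

(** Conjugate by the isomorphism: with [h : X -> Y] and inverse [k], take [h \o f j \o k]. These
    maps are continuous as composites, and since [h] is injective they agree at [y] exactly when the
    [f j] agree at [k y]. Their coincidence set is thus the image under [h] of that of [f], with the
    same cardinality. *)

Lemma continuous_comp (m n p : nat) (X : digital_image m) (Y : digital_image n)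
    (Z : digital_image p) (g : Y -> Z) (f : X -> Y) :
  continuous f -> continuous g -> continuous (g \o f).
Proof. by move=> cf cg S cS; rewrite imset_comp; apply: cg; apply: cf. Qed.

Lemma card_coincidence_conj (I S T : finType) (h : S -> T) (k : T -> S)
    (hK : cancel h k) (kK : cancel k h) (f : I -> S -> S) :
  #|coincidence (fun j => h \o f j \o k)| = #|coincidence f|.
Proof.
(* Moves the right-hand set into [T] by [h], then views it as a preimage under [k], so that
   membership of [y] is a test at [k y]. *)
rewrite -(card_imset _ (can_inj hK)) (can2_imset_pre _ hK kK).
apply: eq_card => y; rewrite !inE.
by apply: eq_forallb => a; apply: eq_forallb => b /=; rewrite (can_eq hK).
Qed.

Theorem theorem3p1 (m n : nat) (X : digital_image m) (Y : digital_image n)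
    (XY : isomorphic X Y) (i : nat) (hi : 3 <= i)
    (f : 'I_i -> X -> X) (hf : forall j : 'I_i, continuous (f j)) :
  exists g : 'I_i -> Y -> Y,
    (forall j : 'I_i, continuous (g j)) /\
    #|coincidence f| = #|coincidence g|.
Proof.
case: XY => h [k [hK kK ch ck]].
exists (fun j => h \o f j \o k); split; last by rewrite card_coincidence_conj.
by move=> j; do 2![apply: continuous_comp => //].
Qed.
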